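(* Let $\mathfrak n_{r,s}$ be a pseudo $H$-type Lie algebra, and let $\mathfrak N_{r,s}$ be the corresponding (connected, simply connected) pseudo $H$-type Lie group, i.e. the Lie group with Lie algebra $\mathfrak n_{r,s}$. Then $\mathfrak N_{r,s}$ admits a lattice.
   Context: A scalar product is a non-degenerate symmetric real bilinear form. A pseudo $H$-type Lie algebra is a finite-dimensional real 2-step nilpotent Lie algebra $\mathfrak n=U\oplus_\perp\mathcal Z$ with centre $\mathcal Z$, endowed with a scalar product $(\cdot,\cdot)=(\cdot,\cdot)_U+(\cdot,\cdot)_{\mathcal Z}$ whose restrictions to $U$ and $\mathcal Z$ are non-degenerate, such that the map $J\colon\mathcal Z\to\mathrm{End}(U)$ defined by $(J_zu,u')_U=(z,[u,u'])_{\mathcal Z}$ for $u,u'\in U$, $z\in\mathcal Z$, satisfies $(J_zu,J_zv)_U=(z,z)_{\mathcal Z}(u,v)_U$ for all $z\in\mathcal Z$, $u,v\in U$. (Equivalently $J_z^2=-(z,z)_{\mathcal Z}\mathrm{Id}_U$, so $U$ is a module over the Clifford algebra of $(\mathcal Z,(\cdot,\cdot)_{\mathcal Z})$ on which the $J_z$ are skew-symmetric.) It is denoted $\mathfrak n_{r,s}$ when $(\mathcal Z,(\cdot,\cdot)_{\mathcal Z})$ is isometric to $\mathbb R^{r,s}$, i.e. $\mathbb R^{r+s}$ with the form $x_1^2+\dots+x_r^2-x_{r+1}^2-\dots-x_{r+s}^2$. A lattice in a Lie group $G$ is a discrete subgroup $K$ such that $K\backslash G$ is compact. *)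

(* Defs.v *)
From HB Require Import structures.
From mathcomp Require Import all_boot all_order all_algebra sesquilinear.
From mathcomp Require Import all_classical all_reals all_analysis.

Set Implicit Arguments.
Unset Strict Implicit.
Unset Printing Implicit Defensive.

Import Order.TTheory GRing.Theory Num.Theory.
Import numFieldNormedType.Exports passmx.

Local Open Scope classical_set_scope.
Local Open Scope ring_scope.

HB.mixin Record Vector_isLieAlgebra (R : fieldType) V of Vector R V := {
  lie : V -> V -> V ;
  lie_linearl : forall y, linear (lie ^~ y) ;
  lie_linearr : forall x, linear (lie x) ;
  liexx : forall x, lie x x = 0 ;
  lie_jacobi : forall x y z,
    lie x (lie y z) + lie y (lie z x) + lie z (lie x y) = 0
}.

#[short(type="lieAlgebraType")]
HB.structure Definition LieAlgebra (R : fieldType) :=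
  {V of Vector R V & Vector_isLieAlgebra R V}.

(* Nilpotency class exactly 2: abelian Lie algebras are excluded. *)
HB.mixin Record LieAlgebra_isTwoStepNilpotent (R : fieldType) V
    of LieAlgebra R V := {
  lie_lie0 : forall x y z : V, lie (lie x y) z = 0 ;
  lie_nonabelian : exists x y : V, lie x y != 0
}.

#[short(type="twoStepNilLieType")]
HB.structure Definition TwoStepNilLie (R : fieldType) :=
  {V of LieAlgebra R V & LieAlgebra_isTwoStepNilpotent R V}.

(* [hJ] is the map J of the structure: since the restriction of [sp] to [hU] is
   non-degenerate, [hJE] determines it uniquely (and forces its linearity). *)
Record pseudoHType (R : realType) (n : twoStepNilLieType R) := PseudoHType {
  sp : {symmetric n} ;
  hU : {vspace n} ;
  hZ : {vspace n} ;
  hZ_center : forall z, z \in hZ <-> forall x, lie z x = 0 ;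
  hUZ_full : (hU + hZ)%VS = fullv ;
  hUZ_direct : directv (hU + hZ) ;
  hUZ_ortho : (hU <= orthov sp hZ)%VS ;
  sp_nondeg : nondegenerate sp ;
  spU_nondeg : (hU :&: orthov sp hU)%VS = 0%VS ;
  spZ_nondeg : (hZ :&: orthov sp hZ)%VS = 0%VS ;
  hJ : subvs_of hZ -> 'End(subvs_of hU) ;
  hJE : forall (z : subvs_of hZ) (u u' : subvs_of hU),
    sp (vsval (hJ z u)) (vsval u') = sp (vsval z) (lie (vsval u) (vsval u')) ;
  hJ_comp : forall (z : subvs_of hZ) (u v : subvs_of hU),
    sp (vsval (hJ z u)) (vsval (hJ z v)) =
    sp (vsval z) (vsval z) * sp (vsval u) (vsval v)
}.

(* Polarization of x_1^2 + ... + x_r^2 - x_{r+1}^2 - ... - x_{r+s}^2. *)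
Definition std_form (R : realType) (r s : nat) (x y : 'rV[R]_(r + s)) : R :=
  \sum_(i < r) x ord0 (lshift s i) * y ord0 (lshift s i) -
  \sum_(i < s) x ord0 (rshift r i) * y ord0 (rshift r i).

Definition center_isometric_Rrs (R : realType) (n : twoStepNilLieType R)
    (h : pseudoHType n) (r s : nat) : Prop :=
  exists f : {linear subvs_of (hZ h) -> 'rV[R]_(r + s)},
    bijective f /\
    forall z w, std_form (f z) (f w) = sp h (vsval z) (vsval w).

HB.mixin Record isTopologicalGroup G of Topological G & Group G := {
  mulg_continuous : continuous (fun x : G * G => (x.1 * x.2)%g) ;
  invg_continuous : continuous (fun x : G => (x^-1)%g)
}.

#[short(type="topologicalGroupType")]
HB.structure Definition TopologicalGroup :=
  {G of Topological G & Group G & isTopologicalGroup G}.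

(* The space K\G of cosets K x. *)
Section LeftQuotient.
Context (G : groupType) (K : groupClosed G).

Definition coset_eq (x y : G) : bool := (x * y^-1)%g \in K.

Lemma coset_eq_refl : reflexive coset_eq.
Proof. by move=> x; rewrite /coset_eq mulgV gpred1. Qed.

Lemma coset_eq_sym : symmetric coset_eq.
Proof. by move=> x y; rewrite /coset_eq -gpredV invgM invgK. Qed.

Lemma coset_eq_trans : transitive coset_eq.
Proof.
move=> y x z; rewrite /coset_eq => xy yz.
by have := gpredM _ _ xy yz; rewrite mulgA mulgVK.
Qed.

Canonical coset_equiv := EquivRel coset_eq coset_eq_refl coset_eq_sym
  coset_eq_trans.

End LeftQuotient.

Arguments coset_equiv {G} K.

Definition left_quotient (G : topologicalGroupType) (K : groupClosed G) :=
  quotient_topology {eq_quot (coset_equiv K)}%qT.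

HB.instance Definition _ G K := Topological.on (@left_quotient G K).

(* [isolated A = A]: the subspace topology on A is discrete. *)
Definition lattice (G : topologicalGroupType) (K : groupClosed G) : Prop :=
  isolated [set` K] = [set` K] /\ compact [set: left_quotient K].

Section LieTheory.
Context (R : realType) (n : twoStepNilLieType R).
Implicit Types x y z : n.

HB.instance Definition _ x :=
  GRing.isLinear.Build R n n _ (lie x) (@lie_linearr R n x).

Lemma lieDl x y z : lie (x + y) z = lie x z + lie y z.
Proof. by have /= := lie_linearl z 1 x y; rewrite !scale1r. Qed.
Lemma lieDr x y z : lie x (y + z) = lie x y + lie x z.
Proof. exact: linearD. Qed.
Lemma lieZr a x y : lie x (a *: y) = a *: lie x y.
Proof. exact: linearZ. Qed.
Lemma lie0l x : lie 0 x = 0.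
Proof. by apply: (addrI (lie 0 x)); rewrite -lieDl !addr0. Qed.
Lemma lie0r x : lie x 0 = 0.
Proof. exact: linear0. Qed.
Lemma lieZl a x y : lie (a *: x) y = a *: lie x y.
Proof. by have /= := lie_linearl y a x 0; rewrite lie0l !addr0. Qed.
Lemma lieC x y : lie y x = - lie x y.
Proof.
have := liexx (x + y).
by rewrite lieDl !lieDr !liexx add0r addr0 => /eqP; rewrite addrC addr_eq0 => /eqP.
Qed.
Lemma lie0lie x y z : lie z (lie x y) = 0.
Proof. by rewrite lieC lie_lie0 oppr0. Qed.
End LieTheory.

(* The connected simply connected Lie group of n, in exponential coordinates:
   its underlying manifold is the vector space n, the exponential map is the
   identity [lieExp], and the product is given by the Baker-Campbell-Hausdorff
   formula x * y = x + y + [x, y] / 2, which is exact as n is 2-step nilpotent.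
   Operations are polynomial in linear coordinates; [lie_coord] is a
   homeomorphism onto R^(dim n) ([coordG_continuous], [coordG_inv_continuous]),
   t |-> lieExp (t *: x) are one-parameter subgroups ([lieExpD]) and group
   commutators recover the bracket ([lieExp_commg]). *)
Definition lieGroup (R : realType) (n : twoStepNilLieType R) : Type := n.

(* Linear coordinates; the topology below does not depend on the basis. *)
Definition lie_coord (R : realType) (n : twoStepNilLieType R) :
    n -> 'rV[R]_(\dim (fullv : {vspace n})) :=
  rVof (vbasis fullv).

HB.instance Definition _ (R : realType) (n : twoStepNilLieType R) :=
  Topological.copy (lieGroup n) (initial_topology (@lie_coord R n)).

Section LieGroup.
Context (R : realType) (n : twoStepNilLieType R).
Local Notation G := (lieGroup n).

Definition bch (x y : G) : G := (x : n) + y + 2^-1 *: lie (x : n) y.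
Definition bch1 : G := (0 : n).
Definition bchV (x : G) : G := - (x : n).

Lemma bchA : associative bch.
Proof.
move=> x y z; rewrite /bch !lieDl !lieDr !lieZl !lieZr lie_lie0 lie0lie.
rewrite !scaler0 !addr0 !scalerDr -!addrA; congr (_ + (_ + _)).
by rewrite [RHS]addrCA; congr (_ + _); rewrite addrC -addrA.
Qed.

Lemma bch1x : left_id bch1 bch.
Proof. by move=> x; rewrite /bch lie0l scaler0 addr0 add0r. Qed.
Lemma bchx1 : right_id bch1 bch.
Proof. by move=> x; rewrite /bch lie0r scaler0 !addr0. Qed.
Lemma bchVx : left_inverse bch1 bchV bch.
Proof.
by move=> x; rewrite /bch /bchV addNr -scaleN1r lieZl liexx !scaler0 add0r.
Qed.
Lemma bchxV : right_inverse bch1 bchV bch.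
Proof.
by move=> x; rewrite /bch /bchV subrr -scaleN1r lieZr liexx !scaler0 add0r.
Qed.

HB.instance Definition _ :=
  isGroup.Build G bchA bch1x bchx1 bchVx bchxV.

Local Notation e := (vbasis (fullv : {vspace n})).
Local Notation coordG :=
  (@lie_coord R n : G -> 'rV[R]_(\dim (fullv : {vspace n}))).

Lemma coordG_continuous : continuous coordG.
Proof. exact: initial_continuous. Qed.

Lemma continuous_coordG (T : topologicalType) (f : T -> G) :
  continuous (coordG \o f) -> continuous f.
Proof.
move=> /continuousP cf; apply/continuousP => _ [B oB <-].
by rewrite -comp_preimage; exact: cf.
Qed.

Lemma coordG_inv_continuous :
  continuous (vecof e : 'rV[R]_(\dim (fullv : {vspace n})) -> G).
Proof.
apply: continuous_coordG => v.
rewrite (_ : coordG \o _ = id) //; apply/funext => w.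
exact: (vecofK (vbasisP fullv)).
Qed.

Lemma coordG_lie (x y : n) :
  coordG (lie x y) = \sum_i \sum_j
    (coordG x 0 i * coordG y 0 j) *:
      coordG (lie e`_i e`_j).
Proof.
have eb : basis_of fullv e := vbasisP _.
rewrite -{1}(rVofK eb x) -{1}(rVofK eb y) /vecof.
rewrite (big_morph (fun u => lie u _) (fun u v => lieDl u v _) (lie0l _)).
rewrite /lie_coord.
rewrite linear_sum; apply: eq_bigr => i _.
rewrite lieZl (big_morph (lie _) (lieDr _) (lie0r _)).
rewrite linearZ linear_sum [LHS]scaler_sumr; apply: eq_bigr => j _.
by rewrite lieZr linearZ [LHS]scalerA.
Qed.

Lemma bch_continuous : continuous (fun x : G * G => (x.1 * x.2)%g).
Proof.
apply: continuous_coordG => p.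
pose c (i : 'I_(\dim (fullv : {vspace n}))) (x : G) := coordG x 0 i.
have cc i : continuous (c i).
  move=> x; apply: (@continuous_comp _ _ _ coordG (fun v => v 0 i)).
    exact: coordG_continuous.
  exact: coord_continuous.
have -> : coordG \o (fun x : G * G => (x.1 * x.2)%g) = (fun x : G * G =>
   coordG x.1 + coordG x.2 + 2^-1 *: \sum_i \sum_j
    (c i x.1 * c j x.2) *:
      coordG (lie e`_i e`_j)).
  apply/funext => x /=; rewrite -coordG_lie /lie_coord.
  by rewrite -[(x.1 * x.2)%g]/(bch x.1 x.2) /bch !linearD linearZ.
have c1 : {for p, continuous (fun x : G * G => coordG x.1)}.
  apply: (@continuous_comp _ _ _ fst coordG); first exact: cvg_fst.
  exact: coordG_continuous.
have c2 : {for p, continuous (fun x : G * G => coordG x.2)}.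
  apply: (@continuous_comp _ _ _ snd coordG); first exact: cvg_snd.
  exact: coordG_continuous.
apply: cvgD; first by apply: cvgD.
apply: cvgZl_tmp.
apply: cvg_big => [|i _]; first exact: add_continuous.
apply: cvg_big => [|j _]; first exact: add_continuous.
apply: cvgZr_tmp.
apply: cvgM.
  by apply: (@continuous_comp _ _ _ fst (c i)); [exact: cvg_fst|exact: cc].
by apply: (@continuous_comp _ _ _ snd (c j)); [exact: cvg_snd|exact: cc].
Qed.

Lemma bchV_continuous : continuous (fun x : G => (x^-1)%g).
Proof.
apply: continuous_coordG => x.
have -> : coordG \o (fun x : G => (x^-1)%g) = (fun x => - coordG x).
  by apply/funext => y /=; rewrite /lie_coord -[(y^-1)%g]/(bchV y) /bchV linearN.
by apply: continuousN; exact: coordG_continuous.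
Qed.

HB.instance Definition _ :=
  isTopologicalGroup.Build G bch_continuous bchV_continuous.

Definition lieExp (x : n) : G := x.

Lemma lieExpD (x : n) (s t : R) :
  lieExp ((s + t) *: x) = (lieExp (s *: x) * lieExp (t *: x))%g.
Proof.
rewrite -[RHS]/(bch (s *: x) (t *: x)) /bch lieZl lieZr liexx !scaler0 addr0.
exact: scalerDl.
Qed.

Lemma lieExp_commg (x y : n) : [~ lieExp x, lieExp y]%g = lieExp (lie x y).
Proof.
have yx : (lieExp x * lieExp y = lieExp y * lieExp x * lieExp (lie x y))%g.
  rewrite -[LHS]/(bch x y) -[RHS]/(bch (bch y x) (lie x y)) /bch.
  rewrite lie0lie scaler0 addr0.
  rewrite [in RHS]lieC scalerN [in RHS](addrC y x) -!addrA; congr (_ + (_ + _)).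
  rewrite -[X in _ = _ + X]scale1r -scaleNr -scalerDl; congr (_ *: _).
  by rewrite [X in _ = _ + X]splitr mul1r addKr.
by rewrite /commg /conjg yx -(mulgA (lieExp y)) mulKg mulKg.
Qed.

End LieGroup.

(* Main.v *)
Require Import Defs.
From HB Require Import structures.
From mathcomp Require Import all_boot all_order all_algebra sesquilinear.
From mathcomp Require Import all_classical all_reals all_analysis.
From mathcomp Require Import ring lra zify.

(** A lattice exists as soon as the Lie algebra [n] has a basis with integral
    structure constants.  For the doubled basis the brackets [[x, y] / 2] of the
    Baker-Campbell-Hausdorff product have integral coordinates, so the points
    with integral coordinates form a group; it is discrete, and rounding
    coordinates down, first for the given point and then for the central
    correction that the product introduces, brings every point into a bounded
    box ([lattice_of_basis], [lattice_of_integral_basis]).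

    Such a basis comes from the Clifford action.  Let [z_1, ..., z_m] be an
    orthonormal basis of the centre, up to signs of the norms.  The [J_(z_i)]
    commute up to sign, square to [1] or [-1] and are self-adjoint up to sign,
    and so are all their products; up to sign there are finitely many of
    these, and they form a group [F] ([sign_group_gen]).  It suffices to find a
    basis [X] of [U], orthonormal up to the signs of the norms, that every
    [J_(z_i)] permutes up to signs: then
    [([x, y], z_i) = (J_(z_i) x, y)] is [0], [1] or [-1].

    The set [X] is a union of [F]-orbits, built one orbit at a time in the
    orthogonal complement of the previous ones ([extend_orthonormal]).  The
    orbit of [v] can be added when [(v, v)] is [1] or [-1] and every [f] in [F]
    satisfies [f v = v], [f v = - v] or [(f v, v) = 0].  Such a [v] is found by
    an extremal choice ([orbit_orthogonal_vector]): among the non-isotropic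
    vectors, take one that is fixed up to sign by as many elements of [F] as
    possible, and among these one that has as many vanishing [(f v, v)] as
    possible.
    If [(f v, v) != 0], then [f] is self-adjoint and commutes with every element
    that fixes [v] up to sign.  When [f^2 = 1], one of [v + f v] and [v - f v]
    is non-isotropic and fixed up to sign by more elements, unless [f] already
    fixes [v] up to sign.  When [f^2 = -1], the vectors [a v + b (f v)] behave
    as the multiples of [v] by complex numbers; a suitable one makes
    [(f v, v)] vanish and preserves the other vanishing values, which
    contradicts the second maximality ([rotate_null]). *)

Set Implicit Arguments.
Unset Strict Implicit.
Unset Printing Implicit Defensive.
Import Order.TTheory GRing.Theory Num.Theory.
Import numFieldNormedType.Exports passmx.
Local Open Scope ring_scope.

(** * Equality up to sign *)

Definition eq_sign (V : zmodType) : rel V := fun x y => (x == y) || (x == - y).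

Lemma eq_signP (V : zmodType) (x y : V) : reflect (x = y \/ x = - y) (eq_sign x y).
Proof. by apply: (iffP orP) => -[/eqP|/eqP]; auto. Qed.

Lemma eq_sign_refl (V : zmodType) (x : V) : eq_sign x x.
Proof. by rewrite /eq_sign eqxx. Qed.

Lemma eq_sign_sym (V : zmodType) : symmetric (@eq_sign V).
Proof. by move=> x y; rewrite /eq_sign [x == y]eq_sym -eqr_oppLR [- x == y]eq_sym. Qed.

Lemma eq_sign_trans (V : zmodType) : transitive (@eq_sign V).
Proof.
move=> y x z /eq_signP[]-> /eq_signP[]->; rewrite /eq_sign ?opprK ?eqxx ?orbT //.
Qed.

Lemma eq_signNl (V : zmodType) (x y : V) : eq_sign (- x) y = eq_sign x y.
Proof. by rewrite /eq_sign eqr_opp orbC eqr_oppLR. Qed.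

(** * Groups of operators up to sign *)

Section SignGroup.
Variables (R : fieldType) (V : vectType R) (B : {symmetric V}).
Implicit Types (f g h : 'End(V)) (F : seq 'End(V)).

Lemma symC u v : B u v = B v u.
Proof. by have := hermC B u v; rewrite expr0 mul1r. Qed.

Lemma symNl u v : B (- u) v = - B u v.
Proof. exact: linearNl. Qed.
Lemma symNr u v : B u (- v) = - B u v.
Proof. exact: linearNr. Qed.
Lemma symDl u v w : B (u + v) w = B u w + B v w.
Proof. exact: linearDl. Qed.
Lemma symDr u v w : B w (u + v) = B w u + B w v.
Proof. exact: linearDr. Qed.
Lemma symZl a u v : B (a *: u) v = a * B u v.
Proof. exact: linearZl_LR. Qed.
Lemma symZr a u v : B u (a *: v) = a * B u v.
Proof. exact: linearZr_LR. Qed.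

Lemma sym_sumr u I (r : seq I) (P : pred I) (E : I -> V) :
  B u (\sum_(i <- r | P i) E i) = \sum_(i <- r | P i) B u (E i).
Proof. exact: linear_sumr. Qed.
Lemma sym_suml u I (r : seq I) (P : pred I) (E : I -> V) :
  B (\sum_(i <- r | P i) E i) u = \sum_(i <- r | P i) B (E i) u.
Proof. by rewrite symC sym_sumr; apply: eq_bigr => i _; rewrite symC. Qed.

Definition sign_comm f g := eq_sign (f \o g)%VF (g \o f)%VF.
Definition sign_adj f :=
  (forall u v, B (f u) v = B u (f v)) \/ (forall u v, B (f u) v = - B u (f v)).

(** A finite set of representatives, modulo sign, of a group of operators whose
    elements behave like the monomials in the generators of a Clifford
    algebra. *)
Record sign_group F : Prop := SignGroup {
  sg_id : \1%VF \in F;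
  sg_comp : forall f g, f \in F -> g \in F -> has (eq_sign (f \o g)%VF) F;
  sg_comm : forall f g, f \in F -> g \in F -> sign_comm f g;
  sg_sq : forall f, f \in F -> eq_sign (f \o f)%VF \1%VF;
  sg_adj : forall f, f \in F -> sign_adj f
}.

Lemma eq_sign_comp f f' g g' : eq_sign f f' -> eq_sign g g' ->
  eq_sign (f \o g)%VF (f' \o g')%VF.
Proof.
by move=> /eq_signP[]-> /eq_signP[]->;
  rewrite ?comp_lfunNl ?comp_lfunNr ?eq_signNl ?eq_sign_refl.
Qed.

Lemma sign_commC f g : sign_comm f g -> sign_comm g f.
Proof. by rewrite /sign_comm eq_sign_sym. Qed.

Lemma sign_comm_comp f g h :
  sign_comm f h -> sign_comm g h -> sign_comm (f \o g)%VF h.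
Proof.
move=> fh gh; rewrite /sign_comm -comp_lfunA.
apply: (eq_sign_trans (eq_sign_comp (eq_sign_refl f) gh)).
by rewrite !comp_lfunA; apply: eq_sign_comp (eq_sign_refl g).
Qed.

Lemma sign_adj_comp f g :
  sign_adj f -> sign_adj g -> sign_comm f g -> sign_adj (f \o g)%VF.
Proof.
move=> af ag /eq_signP cfg.
have adjfg : (forall u v, B (f (g u)) v = B u (g (f v))) \/
             (forall u v, B (f (g u)) v = - B u (g (f v))).
  by case: af ag => af [] ag; [left|right|right|left] => u v; rewrite af ag ?opprK.
case: cfg adjfg => e [] adjfg; [left|right|right|left] => u v;
  by rewrite -?e !comp_lfunE /= adjfg -?[g (f v)]comp_lfunE -?comp_lfunE e
    ?opp_lfunE ?comp_lfunE ?symNr ?opprK.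
Qed.

Lemma sign_sq_comp f g : eq_sign (f \o f)%VF \1%VF ->
  eq_sign (g \o g)%VF \1%VF -> sign_comm f g ->
  eq_sign ((f \o g) \o (f \o g))%VF \1%VF.
Proof.
move=> ff gg fg; rewrite comp_lfunA -(comp_lfunA f g f).
apply: (eq_sign_trans
  (eq_sign_comp (eq_sign_comp (eq_sign_refl f) (sign_commC fg)) (eq_sign_refl g))).
rewrite !comp_lfunA -comp_lfunA; apply: (eq_sign_trans (eq_sign_comp ff gg)).
by rewrite comp_lfun1l eq_sign_refl.
Qed.

(** Modulo sign [f] has order at most two and commutes with [F], so two cosets
    suffice to close [F] after adding [f]. *)
Definition adjoin F f := F ++ [seq (g \o f)%VF | g <- F].

Lemma adjoin_sign_group F f : sign_group F ->
  (forall g, g \in F -> sign_comm f g) -> eq_sign (f \o f)%VF \1%VF ->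
  sign_adj f -> sign_group (adjoin F f).
Proof.
move=> sF cf ff af.
have inP (P : 'End(V) -> Prop) : (forall g, g \in F -> P g) ->
    (forall g, g \in F -> P (g \o f)%VF) -> forall g, g \in adjoin F f -> P g.
  move=> P1 P2 g; rewrite mem_cat => /orP[/P1//|/mapP[k /P2 + ->]]; exact.
have hasl g : has (eq_sign g) F -> has (eq_sign g) (adjoin F f).
  by rewrite has_cat => ->.
have hasr g : has (eq_sign g) F -> has (eq_sign (g \o f)%VF) (adjoin F f).
  move=> /hasP[k kF gk]; apply/hasP; exists (k \o f)%VF.
    by rewrite mem_cat; apply/orP; right; apply/mapP; exists k.
  by apply: eq_sign_comp (eq_sign_refl f).
have has_trans g k : eq_sign g k -> has (eq_sign k) (adjoin F f) ->
    has (eq_sign g) (adjoin F f).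
  by move=> gk /hasP[l lF kl]; apply/hasP; exists l => //; apply: eq_sign_trans kl.
have cff : sign_comm f f by apply: eq_sign_refl.
split.
- by rewrite mem_cat (sg_id sF).
- move=> g k gF; move: k; move: g gF; apply: (inP _) => g gF; apply: (inP _) => k kF.
  + exact/hasl/(sg_comp sF).
  + by rewrite comp_lfunA; apply/hasr/(sg_comp sF).
  + apply: (has_trans _ ((g \o k) \o f)%VF); last exact/hasr/(sg_comp sF).
    by rewrite -!comp_lfunA; apply: eq_sign_comp (eq_sign_refl g) (cf _ kF).
  + apply: (has_trans _ (g \o k)%VF); last exact/hasl/(sg_comp sF).
    rewrite -comp_lfunA; apply: eq_sign_comp (eq_sign_refl g) _.
    rewrite comp_lfunA; apply: (eq_sign_trans (eq_sign_comp (cf _ kF) (eq_sign_refl f))).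
    rewrite -comp_lfunA; apply: (eq_sign_trans (eq_sign_comp (eq_sign_refl k) ff)).
    by rewrite comp_lfun1r eq_sign_refl.
- move=> g k gF; move: k; move: g gF; apply: (inP _) => g gF; apply: (inP _) => k kF.
  + exact: (sg_comm sF).
  + apply/sign_commC/sign_comm_comp; [exact: (sg_comm sF)|exact: cf].
  + apply/sign_comm_comp; [exact: (sg_comm sF)|exact: cf].
  + apply/sign_comm_comp; apply/sign_commC/sign_comm_comp => //.
    * exact: (sg_comm sF).
    * exact: cf.
    * exact/sign_commC/cf.
- apply: (inP _) => g gF; first exact: (sg_sq sF).
  by apply: sign_sq_comp => //; [exact: (sg_sq sF)|exact/sign_commC/cf].
- apply: (inP _) => g gF; first exact: (sg_adj sF).
  by apply: sign_adj_comp => //; [exact: (sg_adj sF)|exact/sign_commC/cf].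
Qed.

(** The finitely many monomials in [S] form the group.  The induction carries
    along that an operator commuting up to sign with the generators does so
    with the whole group: this is what lets the next generator be adjoined. *)
Lemma sign_group_gen (S : seq 'End(V)) :
  {in S &, forall f g, sign_comm f g} ->
  {in S, forall f, eq_sign (f \o f)%VF \1%VF} ->
  {in S, forall f, sign_adj f} ->
  exists2 F, sign_group F & {subset S <= F}.
Proof.
move=> cS qS aS; suff [F [? ? _]] : exists F, [/\ sign_group F, {subset S <= F} &
  forall g, {in S, forall f, sign_comm f g} -> {in F, forall f, sign_comm f g}].
  by exists F.
elim: S cS qS aS => [|f S IH] cS qS aS.
  have c1 g : sign_comm \1%VF g.
    by rewrite /sign_comm comp_lfun1l comp_lfun1r eq_sign_refl.
  exists [:: \1%VF]; split => [|//|g _ k /[!inE]/eqP-> //]; split.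
  - by rewrite inE.
  - by move=> g k /[!inE]/eqP-> /eqP->; rewrite comp_lfun1l /= eq_sign_refl.
  - by move=> g k /[!inE]/eqP-> _.
  - by move=> g /[!inE]/eqP->; rewrite comp_lfun1l eq_sign_refl.
  - by move=> g /[!inE]/eqP->; left => u v; rewrite !id_lfunE.
have sS g : g \in S -> g \in f :: S by rewrite inE orbC => ->.
have fS : f \in f :: S by rewrite mem_head.
have [F [sF SF cF]] := IH (sub_in2 sS cS) (sub_in1 sS qS) (sub_in1 sS aS).
have cfF g : g \in F -> sign_comm g f.
  by apply: cF => k kS; apply: cS => //; apply: sS.
exists (adjoin F f); split.
- apply: adjoin_sign_group sF _ (qS _ fS) (aS _ fS) => g gF.
  exact/sign_commC/cfF.
- move=> g /[!inE] /predU1P[->|/SF gF]; rewrite mem_cat ?gF //.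
  apply/orP; right; apply/mapP; exists \1%VF; first exact: sg_id.
  by rewrite comp_lfun1l.
- move=> g cg k; have cFg := cF g (sub_in1 sS cg).
  rewrite mem_cat => /orP[/cFg//|/mapP[l lF ->]].
  by apply: sign_comm_comp; [exact: cFg|exact: cg].
Qed.

End SignGroup.

(** * Counting and maximising *)

Lemma leq_count (T : eqType) (a b : pred T) (s : seq T) :
  {in s, forall y, a y -> b y} -> (count a s <= count b s)%N.
Proof.
elim: s => //= x s IH ab; apply: leq_add.
  by case: (a x) (ab x (mem_head _ _)) => // ->.
by apply: IH => y ys; apply: ab; rewrite inE ys orbT.
Qed.

Lemma ltn_count (T : eqType) (a b : pred T) (s : seq T) x :
  {in s, forall y, a y -> b y} -> x \in s -> b x -> ~~ a x ->
  (count a s < count b s)%N.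
Proof.
move=> ab xs bx ax; rewrite (permP (perm_to_rem xs) a) (permP (perm_to_rem xs) b) /=.
rewrite bx (negPf ax) add0n ltnS; apply: leq_count => y /mem_rem; exact: ab.
Qed.

Lemma exists_max (T : Type) (P : T -> Prop) (f : T -> nat) (b : nat) :
  (exists x, P x) -> (forall x, (f x <= b)%N) ->
  exists2 x, P x & forall y, P y -> (f y <= f x)%N.
Proof.
move=> [x Px] fb.
have ex : exists n, `[< exists2 y, P y & f y = n >].
  by exists (f x); apply/asboolP; exists x.
have bd n : `[< exists2 y, P y & f y = n >] -> (n <= b)%N.
  by move=> /asboolP[y _ <-].
case: (ex_maxnP ex bd) => n /asboolP[y Py yn] maxn; exists y => // z Pz.
by rewrite yn; apply: maxn; apply/asboolP; exists z.
Qed.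

(** * Vectors with an orthogonal orbit *)

Section OrthogonalOrbit.
Variables (R : rcfType) (V : vectType R) (B : {symmetric V}).
Variables (F : seq 'End(V)).
Hypothesis sF : sign_group B F.
Implicit Types (f g h c p : 'End(V)).

Let sF_comm f g : f \in F -> g \in F ->
  (forall v, f (g v) = g (f v)) \/ (forall v, f (g v) = - g (f v)).
Proof.
move=> fF gF; have /eq_signP[] := sg_comm sF fF gF => /lfunP e; [left|right] => v;
by have := e v; rewrite ?opp_lfunE !comp_lfunE.
Qed.

Let sF_sq f : f \in F -> (forall v, f (f v) = v) \/ (forall v, f (f v) = - v).
Proof.
move=> fF; have /eq_signP[] := sg_sq sF fF => /lfunP e; [left|right] => v;
by have := e v; rewrite ?opp_lfunE comp_lfunE id_lfunE.
Qed.

Let sF_comp f g : f \in F -> g \in F ->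
  exists2 c, c \in F & (forall v, f (g v) = c v) \/ (forall v, f (g v) = - c v).
Proof.
move=> fF gF; have /hasP[c cF /eq_signP[] /lfunP e] := sg_comp sF fF gF;
  exists c => //; [left|right] => v;
by have := e v; rewrite ?opp_lfunE comp_lfunE.
Qed.

Definition sign_fixes v f := eq_sign (f v) v.

Lemma fixes_sym p v : B v v != 0 -> p \in F -> sign_fixes v p ->
  forall u w, B (p u) w = B u (p w).
Proof.
move=> vv pF /eq_signP pv; have [//|pa] := sg_adj sF pF.
have := pa v v; case: pv => ->; rewrite ?symNl ?symNr ?opprK => /eqP;
by rewrite ?(eq_sym (- _)) -subr_eq0 ?opprK -mulr2n mulrn_eq0 (negPf vv).
Qed.

(** If [c] is anti-self-adjoint, then [(c v, v) = - (v, c v)].  If [c]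
    anticommutes with some [p] that fixes [v] up to sign, moving [p] across the
    pairing changes the sign of [(c v, v)].  In both cases it is [0]. *)
Lemma pairing_neq0 c v : B v v != 0 -> c \in F -> B (c v) v != 0 ->
  (forall u w, B (c u) w = B u (c w)) /\
  (forall p, p \in F -> sign_fixes v p -> forall u, c (p u) = p (c u)).
Proof.
move=> vv cF cv; split.
  have [//|ca] := sg_adj sF cF.
  have /eqP := ca v v; rewrite [in X in _ == X]symC -subr_eq0 opprK -mulr2n.
  by rewrite mulrn_eq0 (negPf cv).
move=> p pF pv; have [//|ap] := sF_comm cF pF.
have /eqP := fixes_sym vv pF pv (c v) v.
move: pv => /eq_signP pv.
have : B (p (c v)) v = - B (c (p v)) v by rewrite ap symNl opprK.
by case: pv => ->; rewrite ?linearN ?symNl ?symNr ?opprK => -> /eqP /eqP;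
  rewrite ?(eq_sym (- _)) -subr_eq0 ?opprK -?opprD ?oppr_eq0 -mulr2n mulrn_eq0 (negPf cv).
Qed.

Variable W : {vspace V}.
Hypothesis WF : forall f v, f \in F -> v \in W -> f v \in W.

Definition aniso v := v \in W /\ B v v != 0.

Definition max_fixed v := aniso v /\
  forall w, aniso w -> (count (sign_fixes w) F <= count (sign_fixes v) F)%N.

(** One of [v + c v] and [v - c v] is non-isotropic, since
    their norms add up to [4 (v, v)]; it is fixed up to sign by [c] and by all
    elements that fix [v] up to sign. *)
Lemma max_fixedP v c : max_fixed v -> c \in F ->
  (forall u, c (c u) = u) -> (forall u w, B (c u) w = B u (c w)) ->
  (forall p, p \in F -> sign_fixes v p -> forall u, c (p u) = p (c u)) ->
  sign_fixes v c.
Proof.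
move=> [[vW vv] vmax] cF cc cs cp; apply/negPn/negP => ncv.
have [e [ee we]] : exists e : R, (e = 1 \/ e = - 1) /\
    B (v + e *: c v) (v + e *: c v) != 0.
  have cvv : B (c v) (c v) = B v v by rewrite cs cc.
  have [w1|w1] := eqVneq (B (v + 1 *: c v) (v + 1 *: c v)) 0; last by exists 1; auto.
  exists (- 1); split; first by right.
  apply: contraNneq vv; move: w1.
  rewrite !(symDl, symDr, symZl, symZr) cvv [B (c v) v]symC => w1 w2.
  by apply/eqP; lra.
set w := v + e *: c v in we.
have ww : aniso w by split; rewrite // rpredD ?rpredZ ?WF.
have /(_ w ww) := vmax; rewrite leqNgt => /negP; apply.
apply: (@ltn_count _ _ _ _ c) => //.
  move=> p pF pv; rewrite /sign_fixes /w linearD linearZ /= -cp //.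
  case/eq_signP: pv => ->; first exact: eq_sign_refl.
  by rewrite linearN scalerN -opprD eq_signNl eq_sign_refl.
rewrite /sign_fixes /w linearD linearZ /= cc.
by case: ee => ->; rewrite ?scale1r ?scaleN1r; [rewrite addrC|rewrite -opprB eq_signNl];
  rewrite eq_sign_refl.
Qed.

(** By [max_fixedP], [g^2 = -1].  With [q = (v, v)] and [k = (g v, v)], replacing
    [v] by [w = a v + b (g v)] multiplies the complex number [q - i k] by
    [(a + i b)^2]; hence some [w] has [(g w, w) = 0], and then [(w, w)] is
    nonzero.  An [f] with [(f v, v) = 0] that anticommutes with [g]
    has its pairing multiplied by [a^2 + b^2]; one that commutes with [g] has it
    changed by a multiple of [(g (f v), v)], which maximality forces to be
    [0]. *)
Lemma rotate_null v g : max_fixed v -> g \in F -> ~~ sign_fixes v g ->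
  B (g v) v != 0 ->
  exists w, [/\ aniso w, {in F, forall p, sign_fixes v p -> sign_fixes w p},
    B (g w) w = 0 & {in F, forall f, B (f v) v = 0 -> B (f w) w = 0}].
Proof.
move=> vmax gF gv k0; have [[vW vv] _] := vmax.
have [gs gp] := pairing_neq0 vv gF k0.
have gg u : g (g u) = - u.
  have [gg|//] := sF_sq gF.
  by rewrite (max_fixedP vmax gF gg gs gp) in gv.
have gN u : g (- u) = - g u by exact: linearN.
have gvgv : B (g v) (g v) = - B v v by rewrite gs gg symNr.
have vgv : B v (g v) = B (g v) v by rewrite symC.
pose q : R := B v v; pose k : R := B (g v) v; rewrite -/q -/k in vv k0.
(* [a + i b] is a square root, up to a positive factor, of [q + i k]. *)
have [a [b [ab0 abE]]] : exists a b : R, a ^+ 2 + b ^+ 2 != 0 /\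
    (a ^+ 2 - b ^+ 2) * k = 2 * a * b * q.
  set d := Num.sqrt (q ^+ 2 + k ^+ 2).
  have d2 : d ^+ 2 = q ^+ 2 + k ^+ 2.
    by rewrite sqr_sqrtr // addr_ge0 ?sqr_ge0.
  exists (q + d), k; split; last by ring: d2.
  by rewrite gt_eqF // ltr_wpDl ?sqr_ge0 // exprn_even_gt0.
set w := a *: v + b *: g v.
have gw : g w = a *: g v - b *: v by rewrite linearD !linearZ /= gg scalerN.
have ww : B w w = (a ^+ 2 - b ^+ 2) * q + 2 * a * b * k.
  by rewrite !(symDl, symDr, symZl, symZr) gvgv vgv -/q -/k; ring.
have gww : B (g w) w = 0.
  transitivity ((a ^+ 2 - b ^+ 2) * k - 2 * a * b * q); last by rewrite abE subrr.
  by rewrite gw !(symDl, symNl, symDr, symZl, symZr) gvgv vgv -/q -/k; ring.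
exists w; split => //.
- split; first by rewrite rpredD ?rpredZ ?WF.
  apply: contraNneq ab0 => w0.
  rewrite -sqrf_eq0.
  have : (a ^+ 2 + b ^+ 2) ^+ 2 * (q ^+ 2 + k ^+ 2) = B w w ^+ 2.
    transitivity (B w w ^+ 2 + ((a ^+ 2 - b ^+ 2) * k - 2 * a * b * q) ^+ 2).
      by rewrite ww; ring.
    by rewrite abE subrr expr0n addr0.
  rewrite w0 expr0n /= => /eqP; rewrite mulf_eq0 => /orP[//|].
  by rewrite gt_eqF // ltr_wpDl ?sqr_ge0 // exprn_even_gt0.
- move=> p pF pv; have := gp p pF pv v; rewrite /sign_fixes linearD !linearZ /= => <-.
  case/eq_signP: pv => ->; first exact: eq_sign_refl.
  by rewrite gN !scalerN -opprD eq_signNl eq_sign_refl.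
move=> f fF fv.
have fwE : B (f w) w =
    a * b * (B (f (g v)) v + B (g (f v)) v) + b ^+ 2 * B (g (f (g v))) v.
  have -> : f w = a *: f v + b *: f (g v) by rewrite linearD !linearZ.
  rewrite /w !(symDl, symDr, symZl, symZr) fv.
  by rewrite -![B _ (g v)]gs; ring.
have [fg|fg] := sF_comm fF gF; last first.
  by rewrite fwE fg symNl addNr gN gg opprK fv !mulr0 addr0.
suff gfv : B (g (f v)) v = 0 by rewrite fwE fg gg symNl gfv fv; ring.
apply/eqP/negPn/negP => gfv.
have ginj u u' : g u = g u' -> u = u' by move=> /(congr1 g); rewrite !gg => /oppr_inj.
have [c cF cE] := sF_comp gF fF.
have cv : B (c v) v != 0.
  by case: cE => E; move: gfv; rewrite E // symNl oppr_eq0.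
have [cs cp] := pairing_neq0 vv cF cv.
have gfs u u' : B (g (f u)) u' = B u (g (f u')).
  by case: cE => E; rewrite !E ?symNl ?symNr cs.
have gfp p : p \in F -> sign_fixes v p -> forall u, g (f (p u)) = p (g (f u)).
  by move=> pF pv u; case: cE => E; rewrite !E ?linearN cp.
have fvN0 : sign_fixes v f -> False.
  move=> /eq_signP[] e; move: fv; rewrite e ?symNl => /eqP;
  by rewrite ?oppr_eq0 (negPf vv).
(* If the product [c] of [g] and [f] squares to [1], it fixes [v] up to sign,
   so [f v] is [g v] up to sign and [(f v, v)] could not vanish.  Otherwise
   [f^2 = 1] and [f] itself fixes [v] up to sign. *)
have [cc|cc] := sF_sq cF.
  have /eq_signP gfv' : eq_sign (g (f v)) v.
    have := max_fixedP vmax cF cc cs cp.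
    by case: cE => E; rewrite E // eq_signNl.
  have : B (f v) v = 0 by [].
  have -> : f v = - g (g (f v)) by rewrite gg opprK.
  by case: gfv' => ->; rewrite ?linearN ?opprK ?symNl => /eqP;
    rewrite ?oppr_eq0 (negPf k0).
apply: fvN0; apply: (max_fixedP vmax fF).
- move=> u; apply/ginj/ginj; rewrite -fg.
  have : c (c u) = g (f (g (f u))) by case: cE => E; rewrite !E ?linearN ?opprK.
  by rewrite cc gg fg => <-.
- have [//|fa] := sg_adj sF fF.
  have : B (g (f v)) v = - B (g (f v)) v by rewrite [LHS]gs fa fg symC.
  by move/eqP; rewrite -subr_eq0 opprK -mulr2n mulrn_eq0 (negPf gfv).
- by move=> p pF pv u; apply: ginj; rewrite gfp // (gp p).
Qed.

(** Maximise the number of elements that fix the vector up to sign, then the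
    number of vanishing pairings; by [rotate_null] a pairing with an element
    that does not fix the vector up to sign vanishes.  Rescaling makes the norm
    [1] or [-1]. *)
Lemma orbit_orthogonal_vector : (exists v, aniso v) ->
  exists v, [/\ v \in W, eq_sign (B v v) 1 &
    {in F, forall f, sign_fixes v f \/ B (f v) v = 0}].
Proof.
move=> exW.
have [v0 v0W v0max] := exists_max exW (fun v => count_size (sign_fixes v) F).
have [||v vmax vz] := @exists_max _ max_fixed
    (fun v => count (fun f => B (f v) v == 0) F) (size F).
- by exists v0.
- by move=> v; apply: count_size.
have [[vW vv] vfmax] := vmax.
have vF : {in F, forall f, sign_fixes v f \/ B (f v) v = 0}.
  move=> f fF; have [|fv] := boolP (sign_fixes v f); first by left.
  have [|k0] := eqVneq (B (f v) v) 0; first by right.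
  have [w [wW vw fw zw]] := rotate_null vmax fF fv k0.
  have wmax : max_fixed w.
    split=> // u uW; apply: leq_trans (vfmax u uW) _; exact: leq_count.
  have := vz w wmax; rewrite leqNgt => /negP[].
  apply: (ltn_count _ fF); rewrite ?fw //.
  by move=> g gF /eqP /(zw g gF)/eqP.
pose a := (Num.sqrt `|B v v|)^-1.
have BZ u w : B (a *: u) (a *: w) = `|B v v|^-1 * B u w.
  rewrite symZl symZr mulrA -expr2 exprVn sqr_sqrtr //.
exists (a *: v); split.
- exact: rpredZ.
- rewrite BZ /eq_sign.
  have [p|p] := ger0P (B v v); first by rewrite mulVf ?eqxx.
  by rewrite invrN mulNr mulVf ?eqxx ?orbT.
- move=> f fF; have fa : f (a *: v) = a *: f v by exact: linearZ.
  rewrite fa BZ /sign_fixes fa; have [/eq_signP e|->] := vF f fF; last first.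
    by right; rewrite mulr0.
  by left; apply/eq_signP; case: e => ->; rewrite ?scalerN; auto.
Qed.

End OrthogonalOrbit.

(** * Orthonormal bases permuted up to sign *)

Lemma undup_sign (V : zmodType) (s : seq V) : exists t : seq V,
  [/\ {subset t <= s}, {in s, forall y, has (eq_sign y) t} &
      pairwise (fun x y => ~~ eq_sign x y) t].
Proof.
elim: s => [|x s [t [ts st pt]]]; first by exists [::].
have [xt|xt] := boolP (has (eq_sign x) t).
  exists t; split => // [y /ts|y /[!inE]/predU1P[->//|/st//]].
  by rewrite inE orbC => ->.
exists (x :: t); split.
- by move=> y /[!inE]/predU1P[->|/ts->]; rewrite ?eqxx ?orbT.
- move=> y /[!inE]/predU1P[->|/st ys] /=; first by rewrite eq_sign_refl.
  by rewrite ys orbT.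
- by rewrite pairwise_cons pt andbT all_predC.
Qed.

Section SignOrthonormal.
Variables (R : rcfType) (V : vectType R) (B : {symmetric V}).
Implicit Types (X : seq V) (F : seq 'End(V)).

Definition sign_orthonormal X := [/\ uniq X,
  {in X, forall x, eq_sign (B x x) 1} & {in X &, forall x y, x != y -> B x y = 0}].

Definition sign_stable F X :=
  {in F & X, forall (f : 'End(V)) (x : V), has (eq_sign (f x)) X}.

Lemma span_orthoP X u :
  reflect {in X, forall x, B u x = 0} (u \in orthov B <<X>>).
Proof.
apply: (iffP mem_orthovP) => uX x; first by move/memv_span/uX.
move=> xX; rewrite (@coord_span _ _ _ (in_tuple X) x xX) sym_sumr big1 // => i _.
by rewrite symZr uX ?mulr0 // mem_nth.
Qed.

(** The norms are [1] or [-1], hence their own inverses: this gives the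
    coefficients of the projection. *)
Lemma orthogonal_projection X u : sign_orthonormal X ->
  exists2 w, u - w \in <<X>>%VS & w \in orthov B <<X>>.
Proof.
move=> [uX nX oX]; pose p := \sum_(x <- X) (B x x * B u x) *: x.
exists (u - p).
  rewrite subKr /p big_seq; apply: rpred_sum => x xX.
  by apply/rpredZ/memv_span.
apply/span_orthoP => y yX; rewrite symDl symNl /p sym_suml.
rewrite (bigD1_seq y) //= big_seq_cond big1 => [|x /andP[xX xy]]; last first.
  by rewrite symZl (oX x y) ?mulr0.
rewrite symZl addr0 mulrAC -expr2; have /eq_signP[] := nX y yX => ->.
  by rewrite expr1n mul1r subrr.
by rewrite sqrrN expr1n mul1r subrr.
Qed.

Lemma sign_orthonormal_free X : sign_orthonormal X -> free X.
Proof.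
move=> [uX nX oX]; apply/(@freeP _ _ _ (in_tuple X)) => k k0 i.
have /(congr1 (B^~ X`_i)) := k0; rewrite sym_suml (bigD1 i) //= big1 => [|j ji].
  rewrite symZl linear0l addr0.
  have /nX/eq_signP[] : X`_i \in X by exact: mem_nth.
    by move=> ->; rewrite mulr1.
  by move=> ->; rewrite mulrN1 => /eqP; rewrite oppr_eq0 => /eqP.
by rewrite symZl oX ?mulr0 ?mem_nth // nth_uniq.
Qed.

Variable F : seq 'End(V).
Hypothesis sF : sign_group B F.
Hypothesis Bnd : forall u, (forall v, B u v = 0) -> u = 0.

(** For [f] and [g] in the group, [(f v, g v)] is up to sign [(c v, v)] with
    [c] the product of [g] and [f].  If [c] fixes [v] up to sign then [f v] and
    [g v] agree up to sign; otherwise they are orthogonal. *)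
Lemma orbit_orthonormal v : eq_sign (B v v) 1 ->
  {in F, forall f, sign_fixes v f \/ B (f v) v = 0} ->
  exists X, [/\ {in X, forall x, exists2 f, f \in F & x = f v},
    sign_orthonormal X, sign_stable F X & has (eq_sign v) X].
Proof.
move=> vv fv; have [X [XO OX pX]] := undup_sign [seq (f : 'End(V)) v | f <- F].
have XP x : x \in X -> exists2 f, f \in F & x = f v.
  by move=> /XO/mapP.
have XB x y : x \in X -> y \in X -> eq_sign x y \/ B x y = 0.
  move=> /XP[f fF ->] /XP[g gF ->].
  have /hasP[c cF /eq_signP gfc] := sg_comp sF gF fF.
  have gfv : eq_sign (g (f v)) (c v).
    by apply/eq_signP; case: gfc => /lfunP/(_ v); rewrite ?opp_lfunE comp_lfunE; auto.
  have [cv|cv] := fv c cF.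
    left; have := eq_sign_trans gfv cv; have /eq_signP gg := sg_sq sF gF.
    have ggf : eq_sign (g (g (f v))) (f v).
      by apply/eq_signP; case: gg => /lfunP/(_ (f v));
        rewrite ?opp_lfunE comp_lfunE id_lfunE; auto.
    rewrite eq_sign_sym in ggf => e; apply: (eq_sign_trans ggf).
    apply/eq_signP; case/eq_signP: e => ->; rewrite ?linearN; auto.
  right; have gfv0 : B (g (f v)) v = 0.
    by case/eq_signP: gfv => ->; rewrite ?symNl cv ?oppr0.
  have [ga|ga] := sg_adj sF gF; have := ga (f v) v; rewrite gfv0 => /eqP.
    by rewrite eq_sym => /eqP.
  by rewrite eq_sym oppr_eq0 => /eqP.
have OXh f : f \in F -> has (eq_sign (f v)) X by move=> fF; apply/OX/map_f.
exists X; split=> //.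
- split.
  + have : pairwise (fun x y => x != y) X.
      by apply: sub_pairwise pX => x y; apply: contraNneq => ->; apply: eq_sign_refl.
    by rewrite uniq_pairwise.
  + move=> x /XP[f fF ->].
    have -> : eq_sign (B (f v) (f v)) 1 = eq_sign (B (f (f v)) v) 1.
      by have [fa|fa] := sg_adj sF fF; rewrite [in RHS]fa ?eq_signNl.
    by have /eq_signP[] := sg_sq sF fF => /lfunP/(_ v);
      rewrite ?opp_lfunE comp_lfunE id_lfunE => ->; rewrite ?symNl ?eq_signNl.
  + move=> x y xX yX xy; have [|//] := XB x y xX yX.
    move: pX xX yX xy => /(pairwiseP 0) pX /(nthP 0)[i iX <-] /(nthP 0)[j jX <-] xy e.
    have [ij|ij|ij] := ltngtP i j; last by rewrite ij eqxx in xy.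
      by have := pX i j iX jX ij; rewrite /= e.
    by have := pX j i jX iX ij; rewrite /= eq_sign_sym e.
- move=> f x fF /XP[g gF ->].
  have /hasP[c cF /eq_signP gfc] := sg_comp sF fF gF.
  have gfv : eq_sign (f (g v)) (c v).
    by apply/eq_signP; case: gfc => /lfunP/(_ v); rewrite ?opp_lfunE comp_lfunE; auto.
  have /hasP[y yX cy] := OXh c cF.
  by apply/hasP; exists y => //; apply: eq_sign_trans cy.
- by have := OXh _ (sg_id sF); rewrite id_lfunE.
Qed.

(** The orthogonal complement of [X] is stable under [F], and it contains a
    non-isotropic vector: otherwise, by polarization, it would be totally
    isotropic, hence orthogonal to the whole space. *)
Lemma extend_orthonormal X : sign_orthonormal X -> sign_stable F X ->
  <<X>>%VS != fullv -> exists Y, [/\ sign_orthonormal Y, sign_stable F Y &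
    (\dim <<X>> < \dim <<Y>>)%N].
Proof.
move=> oX sX Xnf; pose W := orthov B <<X>>.
have WF f v : f \in F -> v \in W -> f v \in W.
  move=> fF /span_orthoP vX; apply/span_orthoP => x xX.
  have fvx : B v (f x) = 0.
    have /hasP[y yX /eq_signP[]] := sX f x fF xX => ->; last by rewrite symNr vX ?oppr0.
    by rewrite vX.
  by have [fa|fa] := sg_adj sF fF; rewrite fa fvx ?oppr0.
have XW y w : y \in <<X>>%VS -> w \in W -> B w y = 0.
  by move=> yX /mem_orthovP; apply.
have exW : exists v, aniso B W v.
  apply: contrapT => noW; have W0 w : w \in W -> B w w = 0.
    move=> wW; apply/eqP/negPn/negP => ww; apply: noW; by exists w.
  move/negP: Xnf; apply; rewrite eqEsubv subvf /=.
  apply/subvP => u _; have [w uw wW] := orthogonal_projection u oX.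
  suff w0 : w = 0 by rewrite w0 subr0 in uw.
  apply: Bnd => y; have [y' yy yW] := orthogonal_projection y oX.
  have := W0 _ (rpredD wW yW).
  rewrite symDl !symDr (W0 w) // (W0 y') // [B y' w]symC add0r addr0 => wy.
  by rewrite -(subrK y' y) symDr (XW (y - y')) // add0r; lra.
have [v [vW vv vF]] := orbit_orthogonal_vector sF WF exW.
have [Y [YP [uY nY xY] sY vY]] := orbit_orthonormal vv vF.
have [uX nX xX] := oX.
have YW y : y \in Y -> y \in W by move=> /YP[f fF ->]; apply: WF.
have XYB x y : x \in X -> y \in Y -> B x y = 0.
  by move=> /memv_span xin /YW yW; rewrite symC XW.
have one0 : eq_sign (0 : R) 1 = false.
  by rewrite /eq_sign !(eq_sym 0) oppr_eq0 oner_eq0.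
exists (X ++ Y); split.
- split.
  + rewrite cat_uniq uX uY andbT; apply/hasPn => y yY; apply/negP => yX.
    by have := nX y yX; rewrite XYB ?one0.
  + by move=> x; rewrite mem_cat => /orP[/nX|/nY].
  + move=> x y; rewrite !mem_cat => /orP[xin|xin] /orP[yin|yin] xy.
    * exact: xX.
    * exact: XYB.
    * by rewrite symC XYB.
    * exact: xY.
- move=> f x fF; rewrite mem_cat has_cat => /orP[xin|xin].
    by rewrite sX.
  by rewrite sY ?orbT.
- rewrite span_cat; have := addvSl <<X>> <<Y>> => /dimv_leqif_eq[le eq].
  rewrite ltn_neqAle le eq andbT; apply/negP => /eqP XY.
  have : v \in <<X>>%VS.
    rewrite XY; have /hasP[y yY /eq_signP vy] := vY.
    by apply: (subvP (addvSr _ _)); case: vy => ->; rewrite ?rpredN memv_span.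
  by move=> /XW/(_ vW) v0; rewrite v0 one0 in vv.
Qed.

Theorem sign_orthonormal_basis : exists X,
  [/\ sign_orthonormal X, sign_stable F X & <<X>>%VS = fullv].
Proof.
suff ind m X : (\dim {:V} - \dim <<X>> <= m)%N -> sign_orthonormal X ->
    sign_stable F X -> exists X,
    [/\ sign_orthonormal X, sign_stable F X & <<X>>%VS = fullv].
  by apply: (ind _ [::] (leqnn _)); [split|move=> f x _].
elim: m X => [|m IH] X; have [Xf|Xf] := eqVneq <<X>>%VS fullv.
- by exists X.
- rewrite leqn0 subn_eq0 => Xd; move: Xf; by rewrite eqEdim subvf Xd.
- by exists X.
move=> Xm oX sX; have [Y [oY sY XY]] := extend_orthonormal oX sX Xf.
apply: (IH Y) => //; have := dimvS (subvf <<Y>>%VS); lia.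
Qed.

End SignOrthonormal.

Lemma coord_sign_orthonormal (R : rcfType) (V : vectType R) (B : {symmetric V})
    (X : seq V) (i : 'I_(size X)) (u : V) :
  sign_orthonormal B X -> u \in <<X>>%VS ->
  coord (in_tuple X) i u = B X`_i X`_i * B u X`_i.
Proof.
move=> [uX nX oX] uin; rewrite {2}(@coord_span _ _ _ (in_tuple X) u uin) sym_suml.
rewrite (bigD1 i) //= big1 => [|j ji]; last first.
  by rewrite symZl oX ?mulr0 ?mem_nth ?nth_uniq.
rewrite symZl addr0 mulrCA; have /eq_signP[] := nX _ (mem_nth 0 (ltn_ord i)) => ->.
  by rewrite !mulr1.
by rewrite mulrNN !mulr1.
Qed.

(** * Lattices from integral structure constants *)

Section IntegerPoints.
Local Open Scope classical_set_scope.
Local Open Scope ring_scope.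
Context (R : realType) (n : twoStepNilLieType R).
Local Notation G := (lieGroup n).

Lemma lie_sum (I J : finType) (a : I -> R) (b : J -> R) (x : I -> n) (y : J -> n) :
  lie (\sum_i a i *: x i) (\sum_j b j *: y j) =
  \sum_i \sum_j (a i * b j) *: lie (x i) (y j).
Proof.
rewrite (big_morph (fun u => lie u _) (fun u v => lieDl u v _) (lie0l _)).
apply: eq_bigr => i _; rewrite lieZl (big_morph (lie _) (lieDr _) (lie0r _)).
by rewrite scaler_sumr; apply: eq_bigr => j _; rewrite lieZr scalerA.
Qed.

Lemma lin_continuous (f : {linear n -> R^o}) : continuous (f : G -> R).
Proof.
pose c (i : 'I_(\dim {:n})) (x : G) : R := @lie_coord R n x 0 i.
have -> : (f : G -> R) = (fun x => \sum_i c i x * f (vbasis {:n})`_i).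
  apply/funext => x; rewrite /c /lie_coord -{1}(rVofK (vbasisP {:n}) x) linear_sum.
  by apply: eq_bigr => i _; rewrite linearZ.
move=> x; have Fx : Filter (nbhs x) := nbhs_filter x.
apply: cvg_big => [|i _]; first exact: add_continuous.
apply: cvgMr_tmp; apply: (@continuous_comp _ _ _ (@lie_coord R n : G -> _)
  (fun v : 'rV_(\dim {:n}) => v 0 i)).
  exact: coordG_continuous.
exact: coord_continuous.
Qed.

Lemma lincomb_continuous N (e : 'I_N -> n) :
  continuous (fun v : 'rV[R]_N => (\sum_i v 0 i *: e i : G)).
Proof.
apply: continuous_coordG => v; have Fv : Filter (nbhs v) := nbhs_filter v.
have -> : (@lie_coord R n : G -> _) \o (fun v : 'rV[R]_N => (\sum_i v 0 i *: e i : G)) =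
    (fun v => \sum_i v 0 i *: @lie_coord R n (e i)).
  apply/funext => w /=; rewrite /lie_coord linear_sum.
  by apply: eq_bigr => i _; rewrite linearZ.
apply: cvg_big => [|i _]; first exact: add_continuous.
by apply: cvgZr_tmp; exact: coord_continuous.
Qed.

Variables (N : nat) (e : N.-tuple n).
Hypothesis be : basis_of {:n} e.
Hypothesis he : forall i j l : 'I_N, coord e l (2^-1 *: lie e`_i e`_j) \is a Num.int.

Let h (i j : 'I_N) : n := 2^-1 *: lie e`_i e`_j.

Let coordK (x : n) : x = \sum_i coord e i x *: e`_i.
Proof. exact: coord_basis be (memvf x). Qed.

Let half_lie (x y : n) :
  2^-1 *: lie x y = \sum_i \sum_j (coord e i x * coord e j y) *: h i j.
Proof.
rewrite {1}(coordK x) {1}(coordK y) lie_sum scaler_sumr.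
apply: eq_bigr => i _; rewrite scaler_sumr; apply: eq_bigr => j _.
by rewrite /h !scalerA mulrC.
Qed.

Let hl (a : 'I_N -> 'I_N -> R) (y : n) : lie (\sum_i \sum_j a i j *: h i j) y = 0.
Proof.
rewrite (big_morph (fun u => lie u _) (fun u v => lieDl u v _) (lie0l _)) big1 // => i _.
rewrite (big_morph (fun u => lie u _) (fun u v => lieDl u v _) (lie0l _)) big1 // => j _.
by rewrite lieZl /h lieZl lie_lie0 !scaler0.
Qed.

Let lh (a : 'I_N -> 'I_N -> R) (y : n) : lie y (\sum_i \sum_j a i j *: h i j) = 0.
Proof. by rewrite lieC hl oppr0. Qed.

Definition integer_points : {pred G} :=
  fun x => [forall l, coord e l x \is a Num.int].

Lemma integer_pointsP (x : n) :
  reflect (forall l, coord e l x \is a Num.int) ((x : G) \in integer_points).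
Proof. exact: forallP. Qed.

Let half_lie_int (x y : n) : (x : G) \in integer_points ->
  (y : G) \in integer_points -> (2^-1 *: lie x y : G) \in integer_points.
Proof.
move=> /integer_pointsP xK /integer_pointsP yK; apply/integer_pointsP => l.
rewrite half_lie !linear_sum rpred_sum // => i _; rewrite linear_sum rpred_sum // => j _.
by rewrite linearZ rpredM ?rpredM ?he.
Qed.

Lemma integer_points_mul : mulg_closed integer_points.
Proof.
move=> x y xK yK; have /integer_pointsP xyK := half_lie_int xK yK.
move: xK yK => /integer_pointsP xK /integer_pointsP yK; apply/integer_pointsP => l.
rewrite -[(x * y)%g]/(bch x y) /bch linearD; apply: rpredD; last exact: xyK.
by rewrite linearD /= rpredD.
Qed.

Lemma integer_points1 : 1%g \in integer_points.
Proof. by apply/integer_pointsP => l; rewrite -[1%g]/(0 : n) linear0 rpred0. Qed.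

Lemma integer_pointsV : invg_closed integer_points.
Proof.
move=> x /integer_pointsP xK; apply/integer_pointsP => l.
by rewrite -[(x^-1)%g]/(- (x : n)) linearN /= rpredN.
Qed.

(** Coordinates are continuous, and two integral points whose coordinates
    differ by less than [1] are equal. *)
Lemma integer_points_isolated :
  isolated [set` integer_points] = [set` integer_points].
Proof.
apply/seteqP; split => [|x xK]; first exact: isolatedS.
split; first by rewrite inE.
exists [set y : G | forall l, `|coord e l y - coord e l x| < 1].
  have Fx : Filter (nbhs x) := nbhs_filter x.
  apply: (@filter_forall _ _
    (fun l y => `|coord e l y - coord e l x| < 1) _ Fx) => l.
  have := @lin_continuous (coord e l) x.
  by move=> /cvgrPdist_lt /(_ 1 ltr01); apply: filterS => y; rewrite distrC.
apply/seteqP; split => [y [yx /integer_pointsP yK]|y ->] /=; last first.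
  by split => // l; rewrite subrr normr0.
move: xK => /integer_pointsP xK.
rewrite (coordK x) (coordK y); apply: eq_bigr => l _; congr (_ *: _).
apply/eqP; rewrite -subr_eq0; apply/negPn/negP => /norm_intr_ge1.
by rewrite rpredB // leNgt yx => /(_ isT).
Qed.

(** Large enough for all points with fractional coordinates in [0, 1], corrected
    by a combination of the [h i j] with coefficients in [0, 1]. *)
Let bound : R := 1 + \sum_(l < N) \sum_(i < N) \sum_(j < N) `|coord e l (h i j)|.

Definition box : set G := [set x | forall l, `|coord e l x| <= bound].

Lemma box_compact : compact box.
Proof.
have -> : box = (fun v : 'rV[R]_N => (\sum_i v 0 i *: e`_i : G)) @`
    [set v : 'rV[R]_N | forall i : 'I_N, `[- bound, bound]%classic (v ord0 i)].
  apply/seteqP; split => [x xb|_ [v vb <-] l] /=.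
    exists (\row_i coord e i x) => [i|]; last first.
      by rewrite [RHS]coordK; apply: eq_bigr => i _; rewrite mxE.
    by rewrite mxE /= in_itv /= -ler_norml xb.
  rewrite coord_sum_free ?(basis_free be) //.
  by have := vb l; rewrite /= in_itv /= -ler_norml.
apply: continuous_compact.
  by apply: continuous_subspaceT; apply: lincomb_continuous.
apply: (@rV_compact R N (fun=> `[- bound, bound]%classic)) => i.
exact: segment_compact.
Qed.

(** Let [k1] and [f] be the integral and fractional parts of the coordinates of
    [x].  The product of [k1] and [f] is [x + [k1, f] / 2], and
    [- [k1, f] / 2] is a combination, with unbounded coefficients [w i j], of
    the brackets [h i j].  These are central and integral, so the
    integral part of [w] goes into [k] and its fractional part into [d]. *)
Lemma box_covers (x : G) : exists k d : G,
  [/\ k \in integer_points, box d & x = (k * d)%g].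
Proof.
pose m i : int := Num.floor (coord e i x); pose t i := coord e i x - (m i)%:~R.
pose w i j := - ((m i)%:~R * t j); pose p i j : int := Num.floor (w i j).
pose s i j := w i j - (p i j)%:~R.
have t01 i : 0 <= t i <= 1.
  by have := floor_itv (coord e i x); rewrite intrD /t /m; lra.
have s01 i j : 0 <= s i j <= 1.
  by have := floor_itv (w i j); rewrite intrD /s /p; lra.
pose k1 : n := \sum_i (m i)%:~R *: e`_i; pose f : n := \sum_i t i *: e`_i.
pose c : n := \sum_i \sum_j (p i j)%:~R *: h i j.
pose d : n := \sum_i \sum_j s i j *: h i j.
have fr := basis_free be.
exists (k1 + c), (f + d); split.
- apply/integer_pointsP => l; rewrite linearD /= rpredD //.
    by rewrite coord_sum_free // intr_int.
  rewrite !linear_sum rpred_sum // => i _; rewrite linear_sum rpred_sum // => j _.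
  by rewrite linearZ rpredM ?intr_int ?he.
- move=> l; rewrite linearD /= coord_sum_free // /bound.
  apply: (le_trans (ler_normD _ _)); apply: lerD.
    by rewrite ger0_norm; case/andP: (t01 l).
  rewrite -[leLHS]addr0 [leRHS](bigD1 l) //=.
  apply: lerD; last by do !(apply: sumr_ge0 => ? _).
  rewrite linear_sum; apply: (le_trans (ler_norm_sum _ _ _)); apply: ler_sum => i _.
  rewrite linear_sum; apply: (le_trans (ler_norm_sum _ _ _)); apply: ler_sum => j _.
  rewrite linearZ normrM ger0_norm; last by case/andP: (s01 i j).
  by rewrite ler_piMl //; case/andP: (s01 i j).
- rewrite -[RHS]/(bch (k1 + c) (f + d)) /bch lieDr lh addr0 lieDl hl addr0.
  have -> : 2^-1 *: lie k1 f = \sum_i \sum_j (- w i j) *: h i j.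
    rewrite half_lie; apply: eq_bigr => i _; apply: eq_bigr => j _.
    by rewrite !coord_sum_free // opprK.
  rewrite addrACA.
  have -> : x = k1 + f :> n.
    rewrite [LHS]coordK -big_split; apply: eq_bigr => i _ /=.
    by rewrite -scalerDl addrC subrK.
  rewrite -[LHS]addr0 -!addrA; congr (_ + (_ + _)).
  rewrite -!big_split big1 // => i _ /=; rewrite -!big_split big1 // => j _ /=.
  by rewrite -!scalerDl [X in X *: _](_ : _ = 0) ?scale0r // /s; ring.
Qed.

(** The coset space is the continuous image of the compact [box]. *)
Theorem lattice_of_basis : exists K : groupClosed G, lattice K.
Proof.
pose K : groupClosed G := HB.pack_for (groupClosed G) integer_points
  (isMulClosed.Build G integer_points integer_points_mul)
  (isMul1Closed.Build G integer_points integer_points1)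
  (isInvClosed.Build G integer_points integer_pointsV).
exists K; split; first exact: integer_points_isolated.
have -> : [set: left_quotient K] = \pi_(left_quotient K)%qT @` box.
  apply/seteqP; split => // q _.
  have [k [d [kK dB xkd]]] := box_covers (repr q).
  exists d => //; rewrite -[q]reprK; apply/eqmodP => /=.
  rewrite /coset_eq xkd invgM mulgA mulgV mul1g.
  exact: integer_pointsV.
apply: continuous_compact box_compact.
by apply: continuous_subspaceT; apply: pi_continuous.
Qed.

End IntegerPoints.

(** In the doubled basis, half of a bracket is twice the bracket of the
    original vectors, whose coordinates are then integral. *)
Lemma lattice_of_integral_basis (R : realType) (n : twoStepNilLieType R) N
    (e : N.-tuple n) : basis_of {:n} e ->
  (forall i j l : 'I_N, coord e l (lie e`_i e`_j) \is a Num.int) ->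
  exists K : groupClosed (lieGroup n), lattice K.
Proof.
move=> be ie; pose e2 : N.-tuple n := [tuple of map (fun x : n => 2 *: x) e].
have e2E (i : 'I_N) : e2`_i = 2 *: e`_i by rewrite (nth_map 0) ?size_tuple.
have fe2 : free e2.
  apply/freeP => k k0 i; have /freeP/(_ (fun i => k i * 2)) fe := basis_free be.
  have : k i * 2 = 0.
    by apply: fe; rewrite -[RHS]k0; apply: eq_bigr => j _; rewrite e2E scalerA.
  by move/eqP; rewrite mulf_eq0 pnatr_eq0 orbF => /eqP.
have be2 : basis_of {:n} e2.
  by rewrite basisEfree fe2 subvf size_tuple -(size_basis be) leqnn.
apply: (lattice_of_basis be2) => i j l.
have -> : 2^-1 *: lie e2`_i e2`_j = \sum_k coord e k (lie e`_i e`_j) *: e2`_k.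
  rewrite !e2E lieZl lieZr !scalerA mulrA mulVf ?mul1r ?pnatr_eq0 //.
  rewrite {1}(coord_basis be (memvf (lie e`_i e`_j))) scaler_sumr.
  by apply: eq_bigr => k _; rewrite e2E !scalerA mulrC.
by rewrite coord_sum_free.
Qed.

(** * Clifford action on a pseudo H-type algebra *)

Section FormOn.
Variables (R : fieldType) (V : vectType R) (B : {symmetric V}) (U : {vspace V}).

Definition form_on (u v : subvs_of U) : R := B (vsval u) (vsval v).

Fact form_on_bilinear : bilinear_for
  (GRing.Scale.Law.clone _ _ *%R _) (GRing.Scale.Law.clone _ _ *%R _) form_on.
Proof.
by split=> [u'|u] a x y; rewrite /form_on linearP ?symDl ?symDr ?symZl ?symZr.
Qed.

HB.instance Definition _ := bilinear_isBilinear.Build R _ _ _ _ _ form_on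
  form_on_bilinear.

Fact form_on_sym u v : form_on u v = (-1) ^+ false * idfun (form_on v u).
Proof. by rewrite expr0 mul1r /form_on symC. Qed.

HB.instance Definition _ := @isHermitianSesquilinear.Build R _ false idfun form_on
  form_on_sym.

End FormOn.

Section PseudoHType.
Variables (R : realType) (n : twoStepNilLieType R) (h : pseudoHType n).
Local Notation B := (sp h).
Local Notation U := (subvs_of (hU h)).
Local Notation Z := (subvs_of (hZ h)).
Local Notation BU := (@form_on R n (sp h) (hU h) : {symmetric U}).
Local Notation J := (@hJ _ _ h).

Lemma form_onU_nondeg (u : U) : (forall v, BU u v = 0) -> u = 0.
Proof.
move=> u0; apply: subvs_inj; rewrite linear0; apply/eqP.
rewrite -memv0 -(spU_nondeg h) memv_cap subvsP; apply/mem_orthovP => v vU.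
by have := u0 (vsproj _ v); rewrite /= /form_on vsprojK.
Qed.

Lemma hJ_skew z u v : BU (J z u) v = - BU u (J z v).
Proof. by rewrite [in RHS]symC /= /form_on !hJE lieC symNr. Qed.

(** The Clifford relation.  Polarizing in the centre variable only needs
    [J] to be additive inside the form, which is immediate from its
    definition. *)
Lemma hJ_polar z w u v :
  BU (J z u) (J w v) + BU (J w u) (J z v) = 2 * B (vsval z) (vsval w) * BU u v.
Proof.
have JDl u' v' : BU (J (z + w) u') v' = BU (J z u') v' + BU (J w u') v'.
  by rewrite /= /form_on !hJE linearD symDl.
have JDr u' v' : BU u' (J (z + w) v') = BU u' (J z v') + BU u' (J w v').
  by rewrite symC JDl !(symC _ u').
have := hJ_comp (z + w) u v; rewrite -[LHS]/(BU _ _) JDl !JDr.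
rewrite [vsval (z + w)]linearD /= !(symDl, symDr) -[B (vsval u) _]/(BU u v).
rewrite [B (vsval w) (vsval z)]symC.
have := hJ_comp z u v; rewrite -[LHS]/(BU _ _) => ->.
have := hJ_comp w u v; rewrite -[LHS]/(BU _ _) => ->.
rewrite -[B (vsval u) _]/(BU u v).
have aux (a b c d p q : R) : a * d + p + (q + b * d) = (a + c + (c + b)) * d ->
    p + q = 2 * c * d.
  move=> e; have -> : p + q = (a * d + p + (q + b * d)) - a * d - b * d by ring.
  by rewrite e; ring.
by move=> e; apply: aux e.
Qed.

Lemma eq_form (u w : U) : (forall v, BU u v = BU w v) -> u = w.
Proof.
move=> uw; apply/eqP; rewrite -subr_eq0; apply/eqP/form_onU_nondeg => v.
by rewrite symDl symNl uw subrr.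
Qed.

Lemma hJ_sq z : eq_sign (B (vsval z) (vsval z)) 1 ->
  eq_sign (J z \o J z)%VF \1%VF.
Proof.
move=> zz; have JJ u : J z (J z u) = - (B (vsval z) (vsval z)) *: u.
  apply: eq_form => v; rewrite hJ_skew symZl mulNr; congr (- _).
  exact: hJ_comp.
apply/eq_signP; case/eq_signP: zz => e; [right|left]; apply/lfunP => u;
by rewrite ?opp_lfunE comp_lfunE id_lfunE JJ e ?opprK ?scaleN1r ?scale1r.
Qed.

Lemma hJ_anticomm z w : B (vsval z) (vsval w) = 0 -> sign_comm (J z) (J w).
Proof.
move=> zw; apply/eq_signP; right; apply/lfunP => u.
rewrite opp_lfunE !comp_lfunE; apply: eq_form => v.
rewrite symNl [LHS](hJ_skew z (J w u)) [in RHS](hJ_skew w (J z u)) opprK.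
have := hJ_polar z w u v.
rewrite zw mulr0 mul0r => /eqP; rewrite addr_eq0 => /eqP e.
exact: (esym e).
Qed.

Lemma sign_orthonormal_center r s : center_isometric_Rrs h r s ->
  exists X : seq Z, sign_orthonormal (@form_on R n B (hZ h) : {symmetric Z}) X /\
    <<X>>%VS = fullv.
Proof.
move=> [f [[g fK gK] fB]]; pose z k : Z := g (delta_mx 0 k).
have zz k l : B (vsval (z k)) (vsval (z l)) =
    (if (k < r)%N then 1 else -1) * (k == l)%:R.
  rewrite -fB /z !gK /std_form.
  have d (k' : 'I_(r + s)) : (delta_mx 0 k : 'rV[R]_(r + s)) 0 k' = (k' == k)%:R.
    by rewrite mxE eqxx.
  have d' (k' : 'I_(r + s)) : (delta_mx 0 l : 'rV[R]_(r + s)) 0 k' = (k' == l)%:R.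
    by rewrite mxE eqxx.
  under eq_bigr do rewrite d d'; under [X in _ - X]eq_bigr do rewrite d d'.
  case: (split_ordP k) => k' -> /=.
    rewrite (bigD1 k') //= eqxx mul1r big1 => [|i ik]; last first.
      by rewrite eq_lshift (negPf ik) mul0r.
    rewrite [X in _ - X]big1 => [|i _]; last by rewrite eq_rlshift mul0r.
    by rewrite addr0 subr0.
  rewrite big1 => [|i _]; last by rewrite eq_lrshift mul0r.
  rewrite (bigD1 k') //= eqxx mul1r big1 => [|i ik]; last first.
    by rewrite eq_rshift (negPf ik) mul0r.
  by rewrite addr0 sub0r mulN1r.
have zn k : eq_sign (B (vsval (z k)) (vsval (z k))) 1.
  by rewrite zz eqxx mulr1; case: ifP; rewrite ?eq_signNl eq_sign_refl.
have z_inj : injective z.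
  move=> k l kl; apply/eqP; apply: contraT => /negPf nkl.
  by have := zn k; rewrite {2}kl zz nkl mulr0 /eq_sign !(eq_sym 0) oppr_eq0 oner_eq0.
exists (codom z); split.
  split; first by rewrite map_inj_uniq ?enum_uniq.
    by move=> _ /codomP[k ->]; exact: zn.
  move=> _ _ /codomP[k ->] /codomP[l ->]; rewrite (inj_eq z_inj) => /negPf kl.
  by rewrite /= /form_on zz kl mulr0.
apply/eqP; rewrite eqEsubv subvf; apply/subvP => x _.
have -> : x = \sum_k f x 0 k *: z k.
  apply: (can_inj fK); rewrite linear_sum [LHS]row_sum_delta.
  by apply: eq_bigr => k _; rewrite linearZ /= gK.
by rewrite rpred_sum // => k _; rewrite rpredZ // memv_span // codom_f.
Qed.

(** The bracket is central, hence orthogonal to the part of the basis in [U],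
    and its pairing with a central [z] is [(J_z x, y)], where [J_z x] is a
    basis vector up to sign. *)
Lemma integral_basis r s : center_isometric_Rrs h r s ->
  exists X : seq n, [/\ sign_orthonormal B X, <<X>>%VS = fullv &
    {in X & X, forall x y, {in X, forall w, B (lie x y) w \is a Num.int}}].
Proof.
move=> /sign_orthonormal_center[Y [[uY nY oY] Yf]].
have [F sF YF] : exists2 F, sign_group BU F & {subset map J Y <= F}.
  apply: sign_group_gen.
  - move=> _ _ /mapP[z zY ->] /mapP[w wY ->].
    have [->|zw] := eqVneq z w; first exact: eq_sign_refl.
    exact: hJ_anticomm (oY _ _ zY wY zw).
  - by move=> _ /mapP[z zY ->]; exact: hJ_sq (nY _ zY).
  - by move=> _ /mapP[z zY ->]; right => u v; rewrite hJ_skew.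
have [X [[uX nX oX] sX Xf]] := sign_orthonormal_basis sF form_onU_nondeg.
have UZ u z : u \in hU h -> z \in hZ h -> B u z = 0.
  by move=> /(subvP (hUZ_ortho h)) /mem_orthovP; apply.
have lieZ0 x z : z \in hZ h -> lie z x = 0 by move=> /hZ_center; apply.
have lieZ x y : lie x y \in hZ h by apply/hZ_center => w; rewrite lie_lie0.
exists (map vsval X ++ map vsval Y); split.
- split.
  + rewrite cat_uniq !map_inj_uniq ?uX ?uY //; try exact: subvs_inj.
    rewrite andbT; apply/hasPn => _ /mapP[z zY ->]; apply/mapP => -[u uX' zu].
    have := nY z zY; rewrite /= /form_on {1}zu UZ ?subvsP //.
    by rewrite /eq_sign !(eq_sym 0) oppr_eq0 oner_eq0.
  + by move=> x; rewrite mem_cat => /orP[] /mapP[u uin ->]; [exact: nX|exact: nY].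
  + move=> x y; rewrite !mem_cat => /orP[] /mapP[u uin ->] /orP[] /mapP[v vin ->];
      rewrite ?(inj_eq subvs_inj) => uv.
    * exact: oX.
    * by rewrite UZ ?subvsP.
    * by rewrite symC UZ ?subvsP.
    * exact: oY.
- apply/eqP; rewrite eqEsubv subvf -(hUZ_full h) span_cat; apply: addvS.
    apply/subvP => u uU; rewrite -(vsprojK uU).
    have : vsproj (hU h) u \in <<in_tuple X>>%VS by rewrite Xf memvf.
    move=> /coord_span ->; rewrite linear_sum rpred_sum // => i _.
    by rewrite linearZ rpredZ // memv_span // map_f // mem_nth.
  apply/subvP => u uU; rewrite -(vsprojK uU).
  have : vsproj (hZ h) u \in <<in_tuple Y>>%VS by rewrite Yf memvf.
  move=> /coord_span ->; rewrite linear_sum rpred_sum // => i _.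
  by rewrite linearZ rpredZ // memv_span // map_f // mem_nth.
- move=> x y xX yX w; rewrite mem_cat => /orP[] /mapP[t tin ->].
    by rewrite symC UZ ?subvsP ?rpred0.
  move: xX yX; rewrite !mem_cat => /orP[] /mapP[u uin ->]; last first.
    by rewrite lieZ0 ?subvsP // linear0l rpred0.
  case/orP => /mapP[v vin ->]; last first.
    by rewrite lieC lieZ0 ?subvsP // oppr0 linear0l rpred0.
  rewrite symC -hJE -[B _ _]/(BU (J t u) v).
  have /hasP[u' u'in Ju] := sX _ _ (YF _ (map_f J tin)) uin.
  have uv : BU u' v \is a Num.int.
    have [->|uv] := eqVneq u' v; last by rewrite oX ?rpred0.
    by have /eq_signP[] := nX v vin => ->; rewrite ?rpredN rpred1.
  by case/eq_signP: Ju => ->; rewrite ?symNl ?rpredN.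
Qed.

End PseudoHType.

Theorem theorem9 (R : realType) (n : twoStepNilLieType R)
    (h : pseudoHType n) (r s : nat) (hrs : center_isometric_Rrs h r s) :
  exists K : groupClosed (lieGroup n), lattice K.
Proof.
have [X [oX Xf iX]] := integral_basis hrs.
have bX : basis_of {:n} (in_tuple X).
  by rewrite /basis_of Xf eqxx (sign_orthonormal_free oX).
apply: (lattice_of_integral_basis bX) => i j l.
rewrite (coord_sign_orthonormal l oX) ?Xf ?memvf // rpredM ?iX ?mem_nth //.
have [_ nX _] := oX.
by have /eq_signP[] := nX _ (mem_nth 0 (ltn_ord l)) => ->; rewrite ?rpredN rpred1.
Qed.
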